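(* Consider an instance of the unidirectional maintenance scheduling problem with jobs $1,\dots,n$ satisfying $$r'_1\le r'_2\le\dots\le r'_n\quad\text{and}\quad d'_1\le d'_2\le\dots\le d'_n .$$ Then any shortest path from $0$ to $n$ in the digraph $D$ corresponds to an optimal solution of the problem: if $(0=v_0,v_1,\dots,v_t=n)$ is a minimum weight path from $0$ to $n$ in $D$, then cancelling exactly the train paths in the spans $[\ell_{\alpha(v_s)},\ell_{\beta(v_s,v_{s+1})}]$, $s=0,\dots,t-1$, allows all jobs to be scheduled and is optimal. In particular, the problem under this ordering assumption can be solved in time $O(n^2)$.
   Context: Unidirectional maintenance scheduling problem: there are paths $\mathcal P=\{\ell_1,\dots,\ell_m\}$ and jobs $\mathcal J=\{1,\dots,n\}$; job $j$ is described by integers $r'_j,d'_j,p'_j$ with $1\le r'_j\le d'_j\le m$ and $1\le p'_j\le d'_j-r'_j+1$. Write $[\ell_a,\ell_b]=\{\ell_a,\dots,\ell_b\}$. The possessions of job $j$ are all blocks $[\ell_a,\ell_{a+p'_j-1}]$ with $r'_j\le a\le d'_j-p'_j+1$; their collection is $\mathcal R_j$. A solution selects one possession $R_j\in\mathcal R_j$ for each job, and the objective is to minimise $|\bigcup_j R_j|$ (the number of cancelled paths). Equivalently, one looks for a set of cancelled paths of minimum cardinality that contains a possession of every job; a collection of spans $[\ell_i,\ell_k]$ allows job $j$ to be scheduled if some span $[\ell_i,\ell_k]$ in it contains some $R\in\mathcal R_j$. The directed graph $D$ has node set $\{0,1,\dots,n\}$ and arcs $(v,w)$ for all $0\le v<w\le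 n$. The weight of arc $(v,w)$ is $\beta(v,w)-\alpha(v)+1$, where $$\alpha(v)=\min\{d'_j-p'_j+1 : v+1\le j\le n\}\quad(0\le v\le n-1),$$ $$\beta(v,w)=\max\{\max\{r'_j,\alpha(v)\}+p'_j-1 : v+1\le j\le w\}\quad(0\le v<w\le n).$$ The weight of a path in $D$ is the sum of its arc weights; a shortest path is a path of minimum weight. Running time counts elementary arithmetic operations. *)

(* Defs.v *)
From mathcomp Require Import all_boot all_order all_algebra.

Set Implicit Arguments.
Unset Strict Implicit.
Unset Printing Implicit Defensive.

(* The path l_i (1 <= i <= m) is the element of 'I_m with value i - 1, and job
   j (1 <= j <= n) is the element of 'I_n with value j - 1; the numerical data
   themselves are not shifted. *)

Record instance (m n : nat) := Instance {
  rls : 'I_n -> nat;  (* r'_j *)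
  due : 'I_n -> nat;  (* d'_j *)
  len : 'I_n -> nat;  (* p'_j *)
  rls_due : forall j, 1 <= rls j <= due j;
  due_le : forall j, due j <= m;
  len_bounds : forall j, 1 <= len j <= due j - rls j + 1
}.

Definition ordered m n (I : instance m n) : Prop :=
  forall i j : 'I_n, i <= j -> rls I i <= rls I j /\ due I i <= due I j.

(* [l_a, l_b] *)
Definition block m (a b : nat) : {set 'I_m} := [set x : 'I_m | a <= x.+1 <= b].

Definition possession m n (I : instance m n) (j : 'I_n) (a : nat) : {set 'I_m} :=
  block m a (a + len I j - 1).

Definition possessions m n (I : instance m n) (j : 'I_n) : {set {set 'I_m}} :=
  [set possession I j a | a : 'I_m.+1 & rls I j <= a <= due I j - len I j + 1].

Definition solution m n (I : instance m n) (R : 'I_n -> {set 'I_m}) : Prop :=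
  forall j, R j \in possessions I j.

Definition cancelled m n (R : 'I_n -> {set 'I_m}) : {set 'I_m} :=
  \bigcup_(j < n) R j.

Definition optimal m n (I : instance m n) (R : 'I_n -> {set 'I_m}) : Prop :=
  solution I R /\
  forall R', solution I R' -> #|cancelled R| <= #|cancelled R'|.

Definition allows m n (I : instance m n) (spans : seq {set 'I_m}) (j : 'I_n) : Prop :=
  exists S R : {set 'I_m}, [/\ S \in spans, R \in possessions I j & R \subset S].

(* The default value m is harmless: the range is nonempty for v < n, and
   d'_j - p'_j + 1 <= d'_j <= m. *)
Definition alpha m n (I : instance m n) (v : nat) : nat :=
  \big[minn/m]_(j < n | v <= j) (due I j - len I j + 1).

(* In terms of values of ordinals, v + 1 <= j <= w reads v <= j < w. *)
Definition beta m n (I : instance m n) (v w : nat) : nat :=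
  \max_(j < n | v <= j < w) (maxn (rls I j) (alpha I v) + len I j - 1).

Definition darc n (v w : 'I_n.+1) : bool := v < w.

Definition arc_weight m n (I : instance m n) (v w : 'I_n.+1) : int :=
  ((beta I v w)%:Z - (alpha I v)%:Z + 1)%R.

(* A path (0, v_1, ..., v_t) in D is represented by the sequence v_1, ..., v_t. *)
Definition path_0n n (s : seq 'I_n.+1) : bool :=
  path (@darc n) ord0 s && (last ord0 s == ord_max).

(* The arcs (v_s, v_(s+1)), 0 <= s < t; zip drops the surplus last node. *)
Definition arcs n (s : seq 'I_n.+1) : seq ('I_n.+1 * 'I_n.+1) :=
  zip (ord0 :: s) s.

Definition path_weight m n (I : instance m n) (s : seq 'I_n.+1) : int :=
  (\sum_(e <- arcs s) arc_weight I e.1 e.2)%R.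

Definition shortest_path m n (I : instance m n) (s : seq 'I_n.+1) : Prop :=
  path_0n s /\ forall s', path_0n s' -> (path_weight I s <= path_weight I s')%R.

Definition path_spans m n (I : instance m n) (s : seq 'I_n.+1) : seq {set 'I_m} :=
  [seq block m (alpha I e.1) (beta I e.1 e.2) | e : 'I_n.+1 * 'I_n.+1 <- arcs s].

(* Model of computation: imperative programs over integer variables and
   integer-indexed integer arrays (both named by natural numbers).  Reading a
   constant, a variable or an array entry, an addition, a subtraction, a
   multiplication, a comparison, a write and an empty statement cost 1 each. *)

Inductive expr :=
  | Cst of int
  | Var of nat
  | Get of nat & expr
  | Add of expr & expr
  | Minus of expr & expr
  | Mul of expr & expr.

Inductive test := Le of expr & expr.

Inductive cmd :=
  | Skip
  | Assign of nat & expr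
  | Put of nat & expr & expr  (* Put a i e: entry i of array a becomes e *)
  | Seq of cmd & cmd
  | If of test & cmd & cmd
  | While of test & cmd.

Record store := Store { var : nat -> int; arr : nat -> int -> int }.

Definition set_var (st : store) (x : nat) (z : int) : store :=
  Store (fun y => if y == x then z else var st y) (arr st).

Definition set_arr (st : store) (a : nat) (i z : int) : store :=
  Store (var st)
        (fun b k => if (b == a) && (k == i) then z else arr st b k).

Fixpoint eval (st : store) (e : expr) : int :=
  match e with
  | Cst z => z
  | Var x => var st x
  | Get a i => arr st a (eval st i)
  | Add e1 e2 => (eval st e1 + eval st e2)%R
  | Minus e1 e2 => (eval st e1 - eval st e2)%R
  | Mul e1 e2 => (eval st e1 * eval st e2)%R
  end.

Fixpoint cost (e : expr) : nat :=
  match e with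
  | Cst _ | Var _ => 1
  | Get _ i => (cost i).+1
  | Add e1 e2 | Minus e1 e2 | Mul e1 e2 => (cost e1 + cost e2).+1
  end.

Definition eval_test (st : store) (b : test) : bool :=
  let: Le e1 e2 := b in (eval st e1 <= eval st e2)%R.

Definition cost_test (b : test) : nat :=
  let: Le e1 e2 := b in (cost e1 + cost e2).+1.

(* exec c st st' t: started in st, c terminates in st' after t operations. *)
Inductive exec : cmd -> store -> store -> nat -> Prop :=
  | ExecSkip st : exec Skip st st 1
  | ExecAssign st x e :
      exec (Assign x e) st (set_var st x (eval st e)) (cost e).+1
  | ExecPut st a i e :
      exec (Put a i e) st (set_arr st a (eval st i) (eval st e))
           (cost i + cost e).+1
  | ExecSeq st1 st2 st3 c1 c2 t1 t2 :
      exec c1 st1 st2 t1 -> exec c2 st2 st3 t2 ->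
      exec (Seq c1 c2) st1 st3 (t1 + t2)
  | ExecIfTrue st st' b c1 c2 t :
      eval_test st b -> exec c1 st st' t ->
      exec (If b c1 c2) st st' (cost_test b + t)
  | ExecIfFalse st st' b c1 c2 t :
      ~~ eval_test st b -> exec c2 st st' t ->
      exec (If b c1 c2) st st' (cost_test b + t)
  | ExecWhileTrue st1 st2 st3 b c t1 t2 :
      eval_test st1 b -> exec c st1 st2 t1 -> exec (While b c) st2 st3 t2 ->
      exec (While b c) st1 st3 (cost_test b + t1 + t2)
  | ExecWhileFalse st b c :
      ~~ eval_test st b -> exec (While b c) st st (cost_test b).

(* Value f j at index j, for 1 <= j <= n (job numbering), and 0 elsewhere. *)
Definition load_jobs n (f : 'I_n -> nat) (k : int) : int :=
  (\sum_(j < n | k == j.+1%:Z) (f j)%:Z)%R.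

(* Input: variables 0 and 1 hold n and m; arrays 0, 1 and 2 hold r', d' and p';
   everything else is 0. *)
Definition input m n (I : instance m n) : store :=
  Store (fun x => match x with 0 => n%:Z%R | 1 => m%:Z%R | _ => 0%R end)
        (fun a => match a with
                  | 0 => load_jobs (rls I)
                  | 1 => load_jobs (due I)
                  | 2 => load_jobs (len I)
                  | _ => fun=> 0%R
                  end).

(* Output: entry j of array 3 is the index a of the first path of the possession
   [l_a, l_(a + p'_j - 1)] selected for job j, and this selection is optimal. *)
Definition solved m n (I : instance m n) (st : store) : Prop :=
  exists a : 'I_n -> nat,
    (forall j : 'I_n, arr st 3 j.+1%:Z%R = (a j)%:Z%R) /\
    optimal I (fun j => possession I j (a j)).

(* Main.v *)
Require Import Defs.
From mathcomp Require Import all_boot all_order all_algebra.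
From mathcomp Require Import zify.

Set Implicit Arguments.
Unset Strict Implicit.
Unset Printing Implicit Defensive.

Import Order.TTheory GRing.Theory Num.Theory.

(** Upper bound: on an arc (v,w), every job j in it started at the later of its
    release date and alpha v ends by beta v w, and alpha v, a minimum of latest
    starts, is never too late.  So the spans of any path from 0 to n host all jobs,
    and their union has at most as many elements as the weight of the path
    ([follows_ok], [card_spans]).

    Lower bound ([light_walk]): any set X that hosts all jobs after v dominates the
    weight of some walk from v to n.  First push every possession that starts
    before alpha v to start exactly at alpha v; this does not enlarge X, because
    the longest of the pushed possessions now contains all the others, and its old
    copy, of the same size, is given up ([delay]).  Now the job k attaining alpha v starts at
    alpha v, so X begins with a run from alpha v to some b.  Take the arc
    to the node just before the first job w that cannot be placed in this run.  The order of the jobs enters twice, to show that this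
    arc really separates the jobs.  A job before k has no later deadline than k
    and no earlier latest start, so it is no longer than k and fits inside the
    possession of k; hence the arc is nonempty.  A job after w that
    is placed in the run is not released before w, hence shorter than w, and it can
    move to the end of the possession of w, which lies after the run and ends by the
    deadline of w, which is not later than its own.  So the rest of X hosts all remaining jobs, and induction
    applies ([split_first_component]).

    Both bounds together make every shortest path optimal and force its cancelled
    set to be the whole union of its spans ([shortest_path_schedule_optimal]).

    For the running time, a program computes the distances to node n backwards.
    At node v the value alpha v is obtained from alpha (v+1), and while w
    increases, beta v w is obtained from the previous beta, so every arc costs a
    constant number of operations.  A last linear loop follows the recorded
    successors and writes the canonical start times ([shortest_path_programP]). *)

(** * Paths in the digraph and solutions *)

Section Combinatorics.

Variables m n : nat.
Implicit Types (X S : {set 'I_m}) (s : seq 'I_n.+1) (a b c : nat).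

Lemma card_block a b : 0 < a -> b <= m -> #|block m a b| = b.+1 - a.
Proof.
case: a => // a _ b_le_m; rewrite -sum1_card subSS.
rewrite (eq_bigl (fun x : 'I_m => (a <= x) && (x < b))); last first.
  by move=> x; rewrite inE.
rewrite -(big_mkord (fun x => (a <= x) && (x < b)) (fun=> 1)).
rewrite -(big_nat_widen _ _ _ (fun x => a <= x)) //.
have [a_le_b|b_lt_a] := leqP a b.
  rewrite -{1}(add0n b) -(big_nat_widenl a 0 b xpredT) //.
  by rewrite sum_nat_const_nat muln1.
rewrite big_nat_cond big1 ?(eqP (ltnW b_lt_a)) // => x; lia.
Qed.

Lemma block_sub a b a' b' : a' <= a -> b <= b' -> block m a b \subset block m a' b'.
Proof. move=> aa' bb'; apply/subsetP => x; rewrite !inE; lia. Qed.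

Variable I : instance m n.
Implicit Types (i j k : 'I_n).

Definition latest j := due I j - len I j + 1.

Lemma job_bounds j :
  [/\ 0 < rls I j, rls I j <= latest j, 0 < len I j,
      latest j + len I j = (due I j).+1 & due I j <= m].
Proof.
rewrite /latest; have := rls_due I j; have := due_le I j.
by have := len_bounds I j; split; lia.
Qed.

Definition startable j a := rls I j <= a <= latest j.

Lemma possessionsP j (R : {set 'I_m}) :
  reflect (exists2 a, startable j a & R = possession I j a)
          (R \in possessions I j).
Proof.
apply: (iffP imsetP) => [[a]|[a a_ok ->]]; first by rewrite inE => ? ->; exists a.
have a_lt : a < m.+1.
  by have [] := job_bounds j; move: a_ok; rewrite /startable; lia.
by exists (Ordinal a_lt); rewrite ?inE.
Qed.

Lemma leq_alphaP v x :
  reflect (x <= m /\ forall j, v <= j -> x <= latest j) (x <= alpha I v).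
Proof. exact: (@bigmin_geP _ nat 'I_n m x (fun j => v <= j) latest). Qed.

Lemma alpha_le v j : v <= j -> alpha I v <= latest j.
Proof. by move=> vj; have /leq_alphaP [_ ->] := leqnn (alpha I v). Qed.

Lemma alpha_attained v : v < n -> exists2 k : 'I_n, v <= k & alpha I v = latest k.
Proof.
move=> v_lt_n.
have [k vk kmin] := @arg_minnP _ (Ordinal v_lt_n) (fun j => v <= j) latest (leqnn v).
exists k => //; apply/eqP; rewrite eqn_leq alpha_le //=; apply/leq_alphaP.
by split=> //; have [] := job_bounds k; lia.
Qed.

Lemma alpha_gt0 v : v < n -> 0 < alpha I v.
Proof. by case/alpha_attained=> k _ ->; have [] := job_bounds k; lia. Qed.

Lemma beta_leP v w c :
  reflect (forall j, v <= j < w -> maxn (rls I j) (alpha I v) + len I j - 1 <= c)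
          (beta I v w <= c).
Proof. exact: bigmax_leqP. Qed.

Lemma leq_beta v w j :
  v <= j < w -> maxn (rls I j) (alpha I v) + len I j - 1 <= beta I v w.
Proof. by move=> jvw; apply: (beta_leP _ _ _ (leqnn _)). Qed.

(** Solutions enter the lower bound only through the set they cancel: the rest of
    the argument moves possessions freely inside such a set. *)
Definition hosts X j := exists2 a, startable j a & possession I j a \subset X.

Lemma mem_possession j a (x : 'I_m) :
  (x \in possession I j a) = (a <= x.+1 < a + len I j).
Proof. by have [_ _ p0 _ _] := job_bounds j; rewrite inE; lia. Qed.

Lemma card_possession j a : startable j a -> #|possession I j a| = len I j.
Proof.
rewrite /startable => ?; have [? ? ? ? ?] := job_bounds j.
by rewrite card_block; lia.
Qed.

(** The only place where the set changes is the longest possession K among those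
    starting too early: moving it to alpha v makes it contain all the other early
    ones, moved to alpha v as well, and its old copy leaves X. *)
Lemma delay X v : v < n -> (forall j, v <= j -> hosts X j) ->
  exists X', [/\ forall x, x \in X' -> alpha I v <= x.+1, #|X'| <= #|X|
                 & forall j, v <= j -> hosts X' j].
Proof.
move=> v_lt_n hX.
have /fin_all_exists [a aP] :
    forall j, exists a, v <= j -> startable j a /\ possession I j a \subset X.
  move=> j; case: (leqP v j) => [/hX [a] ? ?|]; first by exists a.
  by exists 0.
pose late := [set x in X | alpha I v <= x.+1].
have lateP j : v <= j -> alpha I v <= a j -> hosts late j.
  move=> vj le_a; have [a_ok /subsetP sub] := aP j vj; exists (a j) => //.
  apply/subsetP => x xP; rewrite inE sub //=.
  by move: xP; rewrite mem_possession; lia.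
have [J /andP [vJ aJ]|no_early] := pickP [pred j : 'I_n | (v <= j) && (a j < alpha I v)];
    last first.
  exists late; split=> [x||j vj]; first by rewrite inE => /andP [].
    by apply: subset_leq_card; apply/subsetP => x; rewrite inE => /andP [].
  by apply: lateP => //; move: (no_early j) => /=; lia.
have {J vJ aJ} [K /andP [vK aK] Kmax] :=
  @arg_maxnP _ J [pred j : 'I_n | (v <= j) && (a j < alpha I v)] (len I)
    (introT andP (conj vJ aJ)).
have [aK_ok Ksub] := aP K vK.
have alphaK : startable K (alpha I v).
  by move: aK_ok (alpha_le vK); rewrite /startable; lia.
pose new := possession I K (alpha I v).
exists (new :|: late); split.
- by move=> x; rewrite in_setU mem_possession inE; lia.
- (* Elements of the old copy of K beyond alpha v lie in the new copy, so late
     minus new avoids the old copy. *)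
  have -> : new :|: late = new :|: (late :\: new).
    by apply/setP => x; rewrite !inE; case: (_ && _).
  rewrite -(cardsID (possession I K (a K)) X) (setIidPr Ksub).
  rewrite card_possession // -(card_possession alphaK).
  apply: leq_trans (leq_card_setU _ _) _; rewrite leq_add2l.
  apply/subset_leq_card/subsetP => x.
  by rewrite !in_setD !mem_possession inE; case: (x \in X); lia.
- move=> j vj; have [le_a|a_lt] := leqP (alpha I v) (a j).
    have [c c_ok sub] := lateP j vj le_a.
    by exists c => //; apply: subset_trans sub (subsetUr _ _).
  have [j_ok _] := aP j vj; exists (alpha I v).
    by move: j_ok a_lt (alpha_le vj); rewrite /startable; lia.
  apply: subset_trans (subsetUl _ _); apply: block_sub => //.
  by have := Kmax j; rewrite /= vj a_lt => /(_ isT); lia.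
Qed.

Hypothesis sorted : ordered I.

(** Stated with the arc weight beta - alpha + 1 rather than the length of the run:
    the arc may end before the run does, which only leaves elements unused. *)
Lemma split_first_component X v : v < n ->
  (forall x, x \in X -> alpha I v <= x.+1) -> (forall j, v <= j -> hosts X j) ->
  exists w (X' : {set 'I_m}), [/\ v < w <= n, alpha I v <= beta I v w,
    (beta I v w).+1 - alpha I v + #|X'| <= #|X| & forall j, w <= j -> hosts X' j].
Proof.
move=> v_lt_n X_ge hX.
have start_ge j a : possession I j a \subset X -> startable j a -> alpha I v <= a.
  have [? ? ? ? ?] := job_bounds j; rewrite /startable => /subsetP sub a_ok.
  have x_lt : a.-1 < m by lia.
  have := X_ge _ (sub (Ordinal x_lt) _); rewrite mem_possession /=; lia.
have [k vk alphaE] := alpha_attained v_lt_n.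
have [ak ak_ok akX] := hX k vk.
have {ak ak_ok akX} [k_ok kX] :
    startable k (alpha I v) /\ possession I k (alpha I v) \subset X.
  suff -> : alpha I v = ak by [].
  by move: (ak_ok) (start_ge k ak akX ak_ok); rewrite /startable alphaE; lia.
(* b is the end of the maximal run of X that starts at alpha v. *)
pose run b := (b <= m) && (block m (alpha I v) b \subset X).
have run_k : run (alpha I v + len I k - 1).
  by rewrite /run -/(possession I k _) kX andbT; have [] := job_bounds k; lia.
have [b /andP [b_le_m bX] bmax] :
    {b | run b & forall c, run c -> c <= b}.
  have run_le c : run c -> c <= m by case/andP.
  have ex_run : exists c, run c by exists (alpha I v + len I k - 1).
  by case: (ex_maxnP ex_run run_le) => b; exists b.
(* A possession starting in the run stays in it, by maximality of b. *)
have dichotomy j a : possession I j a \subset X -> startable j a ->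
    a + len I j - 1 <= b \/ b < a.
  move=> aX a_ok; have le_a := start_ge j a aX a_ok.
  have [a_le_b|] := leqP a b; [left | by right].
  apply: bmax; rewrite /run; apply/andP; split.
    by move: a_ok; have [] := job_bounds j; rewrite /startable; lia.
  apply/subsetP => x; rewrite inE => x_in.
  have [x_le_b|b_lt_x] := leqP x.+1 b.
    by apply: (subsetP bX); rewrite inE; lia.
  by apply: (subsetP aX); rewrite mem_possession; lia.
pose fits j := maxn (rls I j) (alpha I v) + len I j - 1 <= b.
pose X' := X :\: block m (alpha I v) b.
have cardX : b.+1 - alpha I v + #|X'| = #|X|.
  by rewrite -(cardsID (block m (alpha I v) b) X) (setIidPr bX) card_block // alpha_gt0.
have later j a : b < a -> possession I j a \subset X -> possession I j a \subset X'.
  move=> b_lt_a /subsetP sub; apply/subsetP => x x_in.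
  by rewrite in_setD sub // andbT inE; move: x_in; rewrite mem_possession; lia.
suff [w [vw betaw hw]] : exists w, [/\ v < w <= n, beta I v w <= b
    & forall j, w <= j -> hosts X' j].
  exists w, X'; split=> //; last by rewrite -cardX leq_add2r; lia.
  have v_in : v <= Ordinal v_lt_n < w by rewrite /=; lia.
  have := leq_beta v_in; have [] := job_bounds (Ordinal v_lt_n); lia.
(* This makes the arc nonempty: job v is no longer than k and can start with it. *)
have fits_v : fits (Ordinal v_lt_n).
  have [] := @sorted (Ordinal v_lt_n) k vk.
  have := job_bounds (Ordinal v_lt_n); have := job_bounds k => -[? ? ? ? ?] [? ? ? ? ?].
  have := @alpha_le v (Ordinal v_lt_n) (leqnn v); have := bmax _ run_k.
  by rewrite /fits; lia.
have [j0 /andP [vj0 unfit0]|all_fit] := pickP [pred j : 'I_n | (v <= j) && ~~ fits j];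
  last first.
  exists n; split; first lia.
    apply/beta_leP => j /andP [vj _]; apply/negP => /negP unfit.
    by have := all_fit j; rewrite /= vj unfit.
  by move=> j; have := ltn_ord j; lia.
have {j0 vj0 unfit0} [w /andP [vw unfit] wmin] :=
  @arg_minnP _ j0 [pred j : 'I_n | (v <= j) && ~~ fits j] val
    (introT andP (conj vj0 unfit0)).
exists w; split.
- suff : v != w by have := ltn_ord w; move: vw; lia.
  apply: contraNneq unfit => v_w; suff -> : w = Ordinal v_lt_n by [].
  exact: val_inj.
- apply/beta_leP => j /andP [vj jw]; apply/negP => /negP unfitj.
  by have := wmin j; rewrite /= vj unfitj => /(_ isT); rewrite leqNgt jw.
- move=> j wj; have vj : v <= j by move: vw wj => /=; lia.
  have [a a_ok aX] := hX j vj.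
  case: (dichotomy j a aX a_ok) => [end_a|b_lt_a]; last first.
    by exists a => //; apply: later.
  have [c c_ok cX] := hX w vw.
  have le_a := start_ge j a aX a_ok; have le_c := start_ge w c cX c_ok.
  have [rls_wj due_wj] := @sorted w j wj.
  (* j starts past alpha v and past the release date of w, and ends by b, which w
     cannot do: so j is shorter than w. *)
  have {unfit} [len_jw b_lt_c] : len I j < len I w /\ b < c.
    have {vj vw unfit} unfit : b < maxn (rls I w) (alpha I v) + len I w - 1.
      by rewrite ltnNge.
    have /andP [rls_a _] := a_ok; have /andP [rls_c _] := c_ok.
    split; first by clear -unfit rls_a rls_wj le_a end_a; lia.
    by case: (dichotomy w c cX c_ok) => //; clear -rls_c le_c unfit; lia.
  (* With the ends of j and w aligned, the deadline of w protects that of j. *)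
  exists (c + len I w - len I j).
    have [_ _ _ latest_j _] := job_bounds j; have [_ _ _ latest_w _] := job_bounds w.
    move: a_ok c_ok; rewrite /startable.
    by clear -len_jw b_lt_c end_a latest_j latest_w due_wj; lia.
  apply: later; first by clear -len_jw b_lt_c; lia.
  by apply: subset_trans cX; apply: block_sub; clear -len_jw b_lt_c; lia.
Qed.

Local Open Scope ring_scope.

Definition walk_weight (v : 'I_n.+1) s : int :=
  \sum_(e <- zip (v :: s) s) arc_weight I e.1 e.2.

Lemma walk_weight_cons (v w : 'I_n.+1) s :
  walk_weight v (w :: s) = arc_weight I v w + walk_weight w s.
Proof. by rewrite /walk_weight /= big_cons. Qed.

(** The lower bound, for the jobs after v so that the induction can proceed from
    one component of X to the next. *)
Lemma light_walk (v : 'I_n.+1) X : (forall j, (v <= j)%N -> hosts X j) ->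
  exists s, [/\ path (@darc n) v s, last v s = ord_max
               & walk_weight v s <= #|X|%:Z].
Proof.
have [k] := ubnP (n - v)%N; elim: k => // k IHk in v X *; rewrite ltnS => le_k hX.
have [v_lt_n|n_le_v] := ltnP v n; last first.
  exists [::]; split=> //; first by apply/val_inj; have := ltn_ord v; move=> /=; lia.
  by rewrite /walk_weight /= big_nil.
have [X1 [X1_ge X1_card hX1]] := delay v_lt_n hX.
have [w [X2 [/andP [vw wn] alpha_beta X2_card hX2]]] :=
  split_first_component v_lt_n X1_ge hX1.
pose w' : 'I_n.+1 := Ordinal (wn : (w < n.+1)%N).
have [||s [s_path s_last s_weight]] := IHk w' X2; [by rewrite /=; lia | exact: hX2 |].
exists (w' :: s); split=> //; first by rewrite /= /darc vw.
rewrite walk_weight_cons; apply: le_trans (lerD (lexx _) s_weight) _.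
by rewrite /arc_weight -[nat_of_ord w']/w; lia.
Qed.

Lemma beta_le_m v w : (beta I v w <= m)%N.
Proof.
apply/beta_leP => j /andP [vj _]; have := alpha_le vj; have [] := job_bounds j; lia.
Qed.

Lemma alpha_le_beta v w : (v < w <= n)%N -> (alpha I v <= beta I v w)%N.
Proof.
move=> vw; have v_lt_n : (v < n)%N by lia.
have v_in : (v <= Ordinal v_lt_n < w)%N by rewrite /=; lia.
have := leq_beta v_in; have [] := job_bounds (Ordinal v_lt_n); lia.
Qed.

Lemma walk_arcs (v : 'I_n.+1) s :
  path (@darc n) v s -> all (fun e => darc e.1 e.2) (zip (v :: s) s).
Proof. by elim: s v => //= w s IHs v /andP [-> /IHs]. Qed.

Lemma card_spans (es : seq ('I_n.+1 * 'I_n.+1)) : all (fun e => darc e.1 e.2) es ->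
  #|\bigcup_(e <- es) block m (alpha I e.1) (beta I e.1 e.2)|%:Z
    <= \sum_(e <- es) arc_weight I e.1 e.2.
Proof.
elim: es => [|e es IHes] /=; first by rewrite !big_nil cards0.
case/andP=> arc_e /IHes {}IHes; rewrite !big_cons.
have e2_le : (e.1 < e.2 <= n)%N by have := ltn_ord e.2; move: arc_e; rewrite /darc; lia.
have <- : #|block m (alpha I e.1) (beta I e.1 e.2)|%:Z = arc_weight I e.1 e.2.
  rewrite card_block ?beta_le_m ?alpha_gt0 //; last by lia.
  by have := alpha_le_beta e2_le; rewrite /arc_weight; lia.
by apply: le_trans (lerD (lexx _) IHes); rewrite -PoszD lez_nat leq_card_setU.
Qed.

(** The canonical start times: on the arc (v,w) covering job j, j starts as early
    as its release date allows inside the span that opens at alpha v. *)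
Definition follows s (j : 'I_n) (a : nat) := exists2 e, e \in arcs s &
  (e.1 <= j < e.2)%N /\ a = maxn (rls I j) (alpha I e.1).

Lemma walk_covers (v : 'I_n.+1) s j :
  (v <= j < last v s)%N -> exists2 e, e \in zip (v :: s) s & (e.1 <= j < e.2)%N.
Proof.
elim: s v => [|w s IHs] v /=; first by lia.
have [jw vj|wj vj] := ltnP j w.
  by exists (v, w); rewrite ?mem_head //=; lia.
have [|e e_in je] := IHs w; first by lia.
by exists e => //; rewrite in_cons e_in orbT.
Qed.

Lemma follows_exists s : path_0n s -> exists a : 'I_n -> nat, forall j, follows s j (a j).
Proof.
case/andP=> _ /eqP s_last.
have /fin_all_exists [e e_ok] : forall j : 'I_n, exists e,
    e \in arcs s /\ (e.1 <= j < e.2)%N.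
  move=> j; have [|e] := @walk_covers ord0 s j; first by rewrite s_last /=.
  by exists e.
exists (fun j => maxn (rls I j) (alpha I (e j).1)) => j.
by have [? ?] := e_ok j; exists (e j).
Qed.

(** Starting at maxn (rls j) (alpha v) meets the deadline because both terms are at
    most the latest start of j, the second one by the minimum defining alpha v;
    and beta v w is the last end of such a possession. *)
Lemma follows_ok s j a : follows s j a -> startable j a /\
  exists2 S, S \in path_spans I s & possession I j a \subset S.
Proof.
case=> e e_in [/andP [e1j je2] ->]; split.
  by move: (alpha_le e1j); have [] := job_bounds j; rewrite /startable; lia.
exists (block m (alpha I e.1) (beta I e.1 e.2)); first exact: map_f.
by apply: block_sub; [lia | apply: leq_beta; rewrite e1j].
Qed.

(** Squeeze: the cancelled set lies in the union of the spans, whose size is at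
    most the weight of the shortest path, which is at most the size of the set
    cancelled by any solution.  Comparing with the schedule itself turns the
    inclusion into an equality. *)
Theorem shortest_path_schedule_optimal s (a : 'I_n -> nat) :
  shortest_path I s -> (forall j, follows s j (a j)) ->
  optimal I (fun j => possession I j (a j)) /\
  cancelled (fun j => possession I j (a j)) = \bigcup_(S <- path_spans I s) S.
Proof.
move=> [s_path s_min] a_s; set R := fun j => _; set U := \bigcup_(S <- _) S.
have R_sol : solution I R.
  by move=> j; apply/possessionsP; have [? _] := follows_ok (a_s j); exists (a j).
have R_sub : cancelled R \subset U.
  apply/bigcupsP => j _; have [_ [S S_in sub]] := follows_ok (a_s j).
  by apply: subset_trans sub _; rewrite /U (big_rem S) //= subsetUl.
have U_le R' : solution I R' -> (#|U| <= #|cancelled R'|)%N.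
  move=> R'_sol; have [j _|s' [s'_path s'_last s'_weight]] :=
    @light_walk ord0 (cancelled R').
    have /possessionsP [b b_ok R'j] := R'_sol j.
    by exists b => //; rewrite -R'j; apply: (bigcup_sup j).
  rewrite -lez_nat; apply: le_trans s'_weight; apply: le_trans (s_min s' _); last first.
    by rewrite /path_0n s'_path s'_last eqxx.
  rewrite /U /path_spans big_map; apply: card_spans; apply: walk_arcs.
  by case/andP: s_path.
split; last by apply/eqP; rewrite eqEcard R_sub U_le.
by split=> // R' /U_le; apply: leq_trans; apply: subset_leq_card.
Qed.

End Combinatorics.

(** * Total correctness with time bounds *)

Definition terminates c st k (Q : store -> Prop) :=
  exists st' t, [/\ exec c st st' t, t <= k & Q st'].

Lemma terminates_weaken c st k k' (Q Q' : store -> Prop) :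
  terminates c st k Q -> k <= k' -> (forall st', Q st' -> Q' st') ->
  terminates c st k' Q'.
Proof.
move=> [st' [t [run tk Qst]]] kk' QQ'; exists st', t.
by split; [|apply: leq_trans kk'|apply: QQ'].
Qed.

Lemma terminates_seq c1 c2 st k1 k2 (P Q : store -> Prop) :
  terminates c1 st k1 P -> (forall st', P st' -> terminates c2 st' k2 Q) ->
  terminates (Seq c1 c2) st (k1 + k2) Q.
Proof.
move=> [st1 [t1 [run1 t1k Pst]]] /(_ _ Pst) [st2 [t2 [run2 t2k Qst]]].
by exists st2, (t1 + t2); split; [apply: ExecSeq run2|apply: leq_add|].
Qed.

(** Inv i describes the store after i iterations; N, the number of iterations,
    is known in advance for every loop below. *)
Lemma terminates_while b c k N (Inv : nat -> store -> Prop) :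
  (forall i st, i < N -> Inv i st ->
     eval_test st b /\ terminates c st k (Inv i.+1)) ->
  (forall st, Inv N st -> ~~ eval_test st b) ->
  forall st, Inv 0 st ->
    terminates (While b c) st (N * (cost_test b + k) + cost_test b) (Inv N).
Proof.
move=> step stop st Inv0.
suff loop i : i <= N -> forall st, Inv (N - i) st ->
    terminates (While b c) st (i * (cost_test b + k) + cost_test b) (Inv N).
  by apply: loop => //; rewrite subnn.
elim: i => [|i IHi] i_le {Inv0}st Inv_st.
  rewrite subn0 in Inv_st; exists st, (cost_test b); split=> //.
  exact/ExecWhileFalse/stop.
have [||guard [st1 [t1 [run1 t1k]]]] := step (N - i.+1) st; [lia | by [] |].
rewrite subnSK // => /IHi [|st2 [t2 [run2 t2k Inv2]]]; first exact: ltnW.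
exists st2, (cost_test b + t1 + t2); split=> //; first exact: ExecWhileTrue run1 run2.
by rewrite mulSn; lia.
Qed.

Fixpoint loopless c := match c with
  | Skip | Assign _ _ | Put _ _ _ => true
  | Seq c1 c2 | If _ c1 c2 => loopless c1 && loopless c2
  | While _ _ => false
  end.

(** Meaningful on loopless commands only, like [budget]; the values on loops are
    arbitrary. *)
Fixpoint result c st := match c with
  | Skip | While _ _ => st
  | Assign x e => set_var st x (eval st e)
  | Put a i e => set_arr st a (eval st i) (eval st e)
  | Seq c1 c2 => result c2 (result c1 st)
  | If b c1 c2 => if eval_test st b then result c1 st else result c2 st
  end.

Fixpoint budget c := match c with
  | Skip => 1
  | While _ _ => 0
  | Assign _ e => (cost e).+1
  | Put _ i e => (cost i + cost e).+1
  | Seq c1 c2 => budget c1 + budget c2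
  | If b c1 c2 => cost_test b + maxn (budget c1) (budget c2)
  end.

Lemma terminates_loopless c st (Q : store -> Prop) :
  loopless c -> Q (result c st) -> terminates c st (budget c) Q.
Proof.
move=> c_ok Qst; suff [t [run tk]] : exists t, exec c st (result c st) t /\ t <= budget c.
  by exists (result c st), t.
elim: c st c_ok {Qst} => //= [|x e|a i e|c1 IH1 c2 IH2|b c1 IH1 c2 IH2] st.
- by exists 1; split=> //; constructor.
- by exists (cost e).+1; split=> //; constructor.
- by exists (cost i + cost e).+1; split=> //; constructor.
- case/andP=> /(IH1 st) [t1 [run1 le1]] /(IH2 (result c1 st)) [t2 [run2 le2]].
  by exists (t1 + t2); split; [apply: ExecSeq run2|apply: leq_add].
- case/andP=> /(IH1 st) [t1 [run1 le1]] /(IH2 st) [t2 [run2 le2]].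
  case: ifPn => guard.
    exists (cost_test b + t1); split; first exact: ExecIfTrue.
    by rewrite leq_add2l leq_max le1.
  exists (cost_test b + t2); split; first exact: ExecIfFalse.
  by rewrite leq_add2l leq_max le2 orbT.
Qed.

(** * The program *)

Local Notation "c1 ;; c2" := (Seq c1 c2) (at level 70, right associativity).
Local Notation "x <~ e" := (Assign x e) (at level 65).
Local Notation "e1 +' e2" := (Add e1 e2) (at level 50, left associativity).
Local Notation "e1 -' e2" := (Minus e1 e2) (at level 50, left associativity).
Local Notation one := (Cst 1%R).
Local Notation zero := (Cst 0%R).

(** The numbers of x_n, x_m and of the first four arrays are those of the input and
    output conventions; all others are free choices. *)
Local Notation x_n := 0 (only parsing).
Local Notation x_m := 1 (only parsing).
Local Notation x_v := 2 (only parsing).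
Local Notation x_w := 3 (only parsing).
Local Notation x_alpha := 4 (only parsing).
Local Notation x_beta := 5 (only parsing).
Local Notation x_best := 6 (only parsing).
Local Notation x_next := 7 (only parsing).
Local Notation x_start := 8 (only parsing).
Local Notation x_cand := 9 (only parsing).
Local Notation x_job := 10 (only parsing).

Local Notation a_rls := 0 (only parsing).
Local Notation a_due := 1 (only parsing).
Local Notation a_len := 2 (only parsing).
Local Notation a_out := 3 (only parsing).
Local Notation a_dist := 4 (only parsing).
Local Notation a_next := 5 (only parsing).
Local Notation a_alpha := 6 (only parsing).

(** Both branches assign, so that the effect is a single assignment whatever the
    outcome of the test. *)
Definition raise x e := If (Le (Var x) e) (x <~ e) (x <~ Var x).
Definition lower x e := If (Le e (Var x)) (x <~ e) (x <~ Var x).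

Lemma result_raise x e st :
  result (raise x e) st = set_var st x (Num.max (var st x) (eval st e)).
Proof. by rewrite /=; case: lerP. Qed.

Lemma result_lower x e st :
  result (lower x e) st = set_var st x (Num.min (var st x) (eval st e)).
Proof. by rewrite /=; case: lerP. Qed.

Lemma result_seq c1 c2 st : result (c1 ;; c2) st = result c2 (result c1 st).
Proof. by []. Qed.

Lemma result_assign x e st : result (x <~ e) st = set_var st x (eval st e).
Proof. by []. Qed.

Lemma result_put a i e st :
  result (Put a i e) st = set_arr st a (eval st i) (eval st e).
Proof. by []. Qed.

Definition resultE :=
  (result_seq, result_assign, result_put, result_raise, result_lower).

(** The bound m is a valid initial best value: the direct arc from v to n has
    weight at most m, since alpha v is positive and beta is at most m.  The same
    arc makes n a valid initial successor. *)
Definition open_node :=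
  x_v <~ Var x_v -' one ;;
  lower x_alpha (Get a_due (Var x_v +' one) -' Get a_len (Var x_v +' one) +' one) ;;
  x_best <~ Var x_m ;;
  x_next <~ Var x_n ;;
  x_beta <~ zero ;;
  x_w <~ Var x_v.

(** Job w is the last job of the arc (v,w), so the possession it contributes is the
    one that is new compared with the arc (v,w-1). *)
Definition try_arc :=
  x_w <~ Var x_w +' one ;;
  x_start <~ Get a_rls (Var x_w) ;;
  raise x_start (Var x_alpha) ;;
  raise x_beta (Var x_start +' Get a_len (Var x_w) -' one) ;;
  x_cand <~ Var x_beta -' Var x_alpha +' one +' Get a_dist (Var x_w) ;;
  If (Le (Var x_cand) (Var x_best))
     (x_best <~ Var x_cand ;; x_next <~ Var x_w)
     Skip.

Definition close_node :=
  Put a_dist (Var x_v) (Var x_best) ;;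
  Put a_next (Var x_v) (Var x_next) ;;
  Put a_alpha (Var x_v) (Var x_alpha).

Definition scan_arcs := While (Le (Var x_w +' one) (Var x_n)) try_arc.

Definition compute_distances :=
  While (Le one (Var x_v)) (open_node ;; scan_arcs ;; close_node).

(** x_v and x_w hold the ends of the arc in use; a new arc is needed when the next
    job lies beyond x_w. *)
Definition follow_arc :=
  If (Le (Var x_job +' one) (Var x_w))
     Skip
     (x_v <~ Var x_w ;; x_w <~ Get a_next (Var x_w)).

Definition emit_start :=
  x_job <~ Var x_job +' one ;;
  x_start <~ Get a_rls (Var x_job) ;;
  raise x_start (Get a_alpha (Var x_v)) ;;
  Put a_out (Var x_job) (Var x_start).

Definition emit_schedule :=
  While (Le (Var x_job +' one) (Var x_n)) (follow_arc ;; emit_start).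

Definition shortest_path_program :=
  (x_v <~ Var x_n ;; x_alpha <~ Var x_m) ;;
  compute_distances ;;
  (x_w <~ zero ;; x_job <~ zero) ;;
  emit_schedule.

(** * Correctness of the program *)

Section Correctness.

Variables (m n : nat) (I : instance m n).
Implicit Types (v w u k : nat) (j : 'I_n) (s : seq 'I_n.+1) (st : store).

Local Open Scope ring_scope.

Lemma load_jobsE (f : 'I_n -> nat) v (v_lt_n : (v < n)%N) :
  load_jobs f v.+1%:Z = (f (Ordinal v_lt_n))%:Z.
Proof.
set j := Ordinal v_lt_n; rewrite -[v]/(nat_of_ord j) /load_jobs.
rewrite (bigD1 j) //= big_pred0 ?addr0 // => i.
by rewrite eqz_nat eqSS eq_sym -val_eqE; case: eqP.
Qed.

Lemma alpha_recl v (v_lt_n : (v < n)%N) :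
  alpha I v = minn (alpha I v.+1) (latest I (Ordinal v_lt_n)).
Proof.
set j := Ordinal v_lt_n; rewrite -[v]/(nat_of_ord j).
apply/eqP; rewrite eqn_leq leq_min; apply/andP; split.
  rewrite alpha_le // andbT; apply/leq_alphaP.
  by have /leq_alphaP [? h] := leqnn (alpha I j); split=> // i /ltnW /h.
apply/leq_alphaP; split.
  by have /leq_alphaP [? _] := leqnn (alpha I j.+1); rewrite geq_min; apply/orP; left.
move=> i; rewrite leq_eqVlt => /predU1P [/val_inj <-|ji]; first exact: geq_minr.
by apply: leq_trans (geq_minl _ _) _; apply: alpha_le.
Qed.

(** The backward recursion starts from the default value of the empty minimum. *)
Lemma alpha_n : alpha I n = m.
Proof.
apply/eqP; rewrite eqn_leq; have /leq_alphaP [-> _] := leqnn (alpha I n).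
by apply/leq_alphaP; split=> // j; have := ltn_ord j; lia.
Qed.

Lemma beta_nil v : beta I v v = 0%N.
Proof. by apply/eqP; rewrite -leqn0; apply/beta_leP => j; lia. Qed.

Lemma beta_recr v w (w_lt_n : (w < n)%N) (j := Ordinal w_lt_n) : (v <= w)%N ->
  beta I v w.+1 = maxn (beta I v w) (maxn (rls I j) (alpha I v) + len I j - 1).
Proof.
rewrite -[w]/(nat_of_ord j) => vj; apply/eqP; rewrite eqn_leq geq_max; apply/andP; split.
  apply/beta_leP => i /andP [vi]; rewrite ltnS leq_eqVlt => /predU1P [/val_inj ->|ij].
    exact: leq_maxr.
  by apply: leq_trans (leq_maxl _ _); apply: leq_beta; rewrite vi.
apply/andP; split; last by apply: leq_beta; rewrite vj leqnn.
by apply/beta_leP => i /andP [vi ij]; apply: leq_beta; rewrite vi ltnW.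
Qed.

Definition via (dist : int -> int) v w : int :=
  (beta I v w)%:Z - (alpha I v)%:Z + 1 + dist w.

(** Bellman's equation at v, with the successor w as a witness.  Read from v = n - 1
    downwards, it determines dist; the tables are functions on integers because
    arrays are. *)
Definition settled (dist next alphas : int -> int) v :=
  alphas v = (alpha I v)%:Z /\
  exists w, [/\ (v < w <= n)%N, next v = w, via dist v w <= dist v
              & forall w', (v < w' <= n)%N -> dist v <= via dist v w'].

Definition inputs st :=
  [/\ var st x_n = n, var st x_m = m, arr st a_rls = load_jobs (rls I),
      arr st a_due = load_jobs (due I) & arr st a_len = load_jobs (len I)].

(** u0 is the first node whose table entries are final: v itself between two rounds
    of the outer loop, v+1 while the arcs out of v are scanned. *)
Definition at_node v u0 st :=
  [/\ inputs st, var st x_v = v, var st x_alpha = alpha I v,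
      arr st a_dist n = 0
    & forall u, (u0 <= u < n)%N ->
        settled (arr st a_dist) (arr st a_next) (arr st a_alpha) u].

Definition distances_from v st := at_node v v st.

Definition scanned v w st :=
  [/\ var st x_w = w, var st x_beta = beta I v w
    & exists w0, [/\ (v < w0 <= n)%N, var st x_next = w0,
        via (arr st a_dist) v w0 <= var st x_best
      & forall w', (v < w' <= w)%N -> var st x_best <= via (arr st a_dist) v w']].

Definition scanning v w st := at_node v v.+1 st /\ scanned v w st.

Lemma int_predS v : v.+1%:Z - 1 = v%:Z.
Proof. lia. Qed.

Lemma int_succ v : v%:Z + 1 = v.+1%:Z.
Proof. lia. Qed.

Lemma open_nodeP v st : (v < n)%N -> distances_from v.+1 st ->
  scanning v v (result open_node st).
Proof.
move=> v_lt_n [[n_st m_st rls_st due_st len_st] v_st alpha_st dist_n nodes].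
pose j := Ordinal v_lt_n.
rewrite /open_node !resultE; split.
  split.
  - by split; rewrite /= ?n_st.
  - by rewrite /= v_st int_predS.
  - rewrite /= v_st int_predS int_succ alpha_st due_st len_st.
    rewrite !(load_jobsE _ v_lt_n) (alpha_recl v_lt_n) /latest.
    have [] := job_bounds I j; rewrite -/j /latest; lia.
  - by [].
  - by move=> u u_in; apply: nodes.
split.
- by rewrite /= v_st int_predS.
- by rewrite /= beta_nil.
- exists n; split; [lia | by rewrite /= n_st | | by move=> ?; lia].
  rewrite /via /= dist_n m_st; have := beta_le_m I v n; have := alpha_gt0 I v_lt_n; lia.
Qed.

Lemma try_arcP v w st : (v <= w < n)%N -> scanning v w st ->
  var st x_w + 1 <= var st x_n /\ scanning v w.+1 (result try_arc st).
Proof.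
move=> /andP [vw w_lt_n] [[[n_st m_st rls_st due_st len_st] v_st alpha_st dist_n nodes]].
move=> [w_st beta_st [w0 [w0_in next_st best_ge best_le]]].
split; first by rewrite w_st n_st; lia.
pose j := Ordinal w_lt_n.
(* The store just before the comparison with the best arc so far. *)
set st1 := result (x_w <~ Var x_w +' one ;;
  x_start <~ Get a_rls (Var x_w) ;;
  raise x_start (Var x_alpha) ;;
  raise x_beta (Var x_start +' Get a_len (Var x_w) -' one) ;;
  x_cand <~ Var x_beta -' Var x_alpha +' one +' Get a_dist (Var x_w)) st.
have -> : result try_arc st = result (If (Le (Var x_cand) (Var x_best))
     (x_best <~ Var x_cand ;; x_next <~ Var x_w) Skip) st1 by [].
have w_st1 : var st1 x_w = w.+1 by rewrite /st1 !resultE /= w_st int_succ.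
have beta_st1 : var st1 x_beta = beta I v w.+1.
  rewrite /st1 !resultE /= w_st int_succ alpha_st beta_st rls_st len_st.
  rewrite !(load_jobsE _ w_lt_n) (beta_recr w_lt_n vw).
  by have [_ _ ? _ _] := job_bounds I j; rewrite -/j; lia.
have cand_st1 : var st1 x_cand = via (arr st a_dist) v w.+1.
  rewrite /via -beta_st1 /st1 !resultE /= w_st int_succ alpha_st; lia.
have best_st1 : var st1 x_best = var st x_best by rewrite /st1 !resultE.
have next_st1 : var st1 x_next = var st x_next by rewrite /st1 !resultE.
have -> : result (If (Le (Var x_cand) (Var x_best))
     (x_best <~ Var x_cand ;; x_next <~ Var x_w) Skip) st1 =
   if var st1 x_cand <= var st1 x_best then
     set_var (set_var st1 x_best (var st1 x_cand)) x_next (var st1 x_w) else st1.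
  by [].
have stage : at_node v v.+1 st1.
  by rewrite /st1 !resultE; split; first by split.
have dist_st1 : arr st1 a_dist = arr st a_dist by rewrite /st1 !resultE.
clearbody st1; split; first by case: ifP => _; case: stage => -[? ? ? ? ?]; split=> //; split.
have [better|worse] := lerP.
  split=> //=; exists w.+1; rewrite dist_st1 cand_st1; split=> //.
    by rewrite ltnS vw.
  move=> w' /andP [vw']; rewrite leq_eqVlt => /predU1P [-> //|w'w].
  by rewrite -cand_st1 (le_trans better) // best_st1 best_le // vw'.
split=> //; exists w0; rewrite next_st1 best_st1 dist_st1; split=> //.
move=> w' /andP [vw']; rewrite leq_eqVlt => /predU1P [-> | w'w].
  by rewrite -best_st1 -cand_st1 ltW.
by apply: best_le; rewrite vw'.
Qed.

Lemma scan_arcsP v st : (v < n)%N -> scanning v v st ->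
  terminates scan_arcs st
    ((n - v) * (cost_test (Le (Var x_w +' one) (Var x_n)) + budget try_arc) +
     cost_test (Le (Var x_w +' one) (Var x_n)))%N
    (scanning v n).
Proof.
move=> v_lt_n st_v.
have -> : scanning v n = scanning v (v + (n - v))%N by rewrite subnKC // ltnW.
apply: (terminates_while (Inv := fun i => scanning v (v + i)%N)); last by rewrite addn0.
  move=> i st1 i_lt /try_arcP []; first by lia.
  by move=> guard st2; split=> //; apply: terminates_loopless; rewrite ?addnS.
move=> st1 [[[n_st _ _ _ _] _ _ _ _] [w_st _ _]] /=.
by rewrite n_st w_st; lia.
Qed.

(** Bellman's equation at v reads the tables at v and later nodes only, so writing
    the entries of an earlier node preserves it. *)
Lemma settled_ext (dist dist' next next' alphas alphas' : int -> int) v :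
  (forall u, (v <= u)%N -> [/\ dist' u = dist u, next' u = next u & alphas' u = alphas u]) ->
  settled dist next alphas v -> settled dist' next' alphas' v.
Proof.
move=> ext [alpha_v [w [w_in next_v dist_ge dist_le]]].
have viaE w' : (v < w')%N -> via dist' v w' = via dist v w'.
  by move=> vw; rewrite /via; have [-> _ _] := ext w' (ltnW vw).
have [dist_v' next_v' alpha_v'] := ext v (leqnn v).
rewrite /settled alpha_v' next_v' dist_v'; split=> //; exists w; split=> //.
  by rewrite viaE //; case/andP: w_in.
by move=> w' w'_in; rewrite viaE ?dist_le //; case/andP: w'_in.
Qed.

Lemma close_nodeP v st : (v < n)%N -> scanning v n st ->
  distances_from v (result close_node st).
Proof.
move=> v_lt_n [[inp v_st alpha_st dist_n nodes]].
move=> [w_st beta_st [w0 [w0_in next_st best_ge best_le]]].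
have put_v (f : int -> int) z u : (v < u)%N -> (if u%:Z == v then z else f u%:Z) = f u%:Z.
  by move=> vu; rewrite eqz_nat gtn_eqF.
have put_via (f : int -> int) z w : (v < w)%N ->
    via (fun x : int => if x == v%:Z then z else f x) v w = via f v w.
  by move=> vw; rewrite /via put_v.
rewrite /close_node !resultE /= v_st; split=> //=.
  by rewrite put_v.
move=> u /andP []; rewrite leq_eqVlt => /predU1P [<- _|vu u_lt_n].
  split; first by rewrite eqxx.
  exists w0; rewrite eqxx; case/andP: (w0_in) => vw0 _; split=> //.
    by rewrite put_via.
  by move=> w' w'_in; rewrite put_via ?best_le //; case/andP: w'_in.
apply: settled_ext (nodes u _); last by rewrite vu.
by move=> u' uu'; rewrite /= !put_v //; apply: leq_trans uu'.
Qed.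

Definition distances_time : nat :=
  cost_test (Le one (Var x_v)) + (n *
   (cost_test (Le one (Var x_v)) + (budget open_node +
     (n * (cost_test (Le (Var x_w +' one) (Var x_n)) + budget try_arc) +
     cost_test (Le (Var x_w +' one) (Var x_n)) + budget close_node)))).

Lemma compute_distancesP st : distances_from n st ->
  terminates compute_distances st distances_time (distances_from 0).
Proof.
move=> st_n; rewrite /distances_time addnC -(subnn n).
apply: (terminates_while (Inv := fun i => distances_from (n - i)%N)); last by rewrite subn0.
  move=> i st1 i_lt; have -> : (n - i = (n - i.+1).+1)%N by lia.
  have v_lt_n : (n - i.+1 < n)%N by lia.
  move: (n - i.+1)%N v_lt_n => v v_lt_n st1_v; split.
    by have [_ v_st _ _ _] := st1_v; rewrite /= v_st.
  apply: terminates_seq (_ : terminates open_node st1 _ (scanning v v)) _.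
    by apply: terminates_loopless => //; apply: open_nodeP.
  move=> st2 st2_v; apply: terminates_seq (_ : terminates _ _ _ (scanning v n)) _.
    apply: terminates_weaken (scan_arcsP v_lt_n st2_v) _ _ => //.
    by rewrite leq_add2r leq_mul2r leq_subr orbT.
  by move=> st3 st3_v; apply: terminates_loopless => //; apply: close_nodeP.
by move=> st1 [_ v_st _ _ _]; rewrite /= v_st subnn.
Qed.

Lemma distance_le_walk (dist next alphas : int -> int) (v : 'I_n.+1) s : dist n = 0 ->
  (forall u, (u < n)%N -> settled dist next alphas u) ->
  path (@darc n) v s -> last v s = ord_max -> dist v <= walk_weight I v s.
Proof.
move=> dist_n nodes; elim: s v => [|w s IHs] v /=.
  by move=> _ ->; rewrite /walk_weight big_nil dist_n.
case/andP=> vw /IHs {}IHs /IHs {}IHs; rewrite walk_weight_cons.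
have w_le : (w <= n)%N by have := ltn_ord w.
have v_lt_n : (v < n)%N by apply: leq_trans w_le.
have [_ [_ [_ _ _ dist_le]]] := nodes v v_lt_n.
apply: le_trans (dist_le w _) _; first exact/andP.
by rewrite /via /arc_weight lerD2l.
Qed.

Definition tables_loaded (next alphas : int -> int) st :=
  [/\ var st x_n = n, arr st a_rls = load_jobs (rls I),
      arr st a_next = next & arr st a_alpha = alphas].

Definition emitted s k st := forall j, (j < k)%N ->
  exists2 a, follows I s j a & arr st a_out j.+1%:Z = a%:Z.

Definition on_arc s k st := exists2 e, e \in arcs s &
  [/\ e.2 = last ord0 s, var st x_v = e.1 & (e.1 <= k < e.2)%N].

Definition between_jobs s k st := last ord0 s = k :> nat \/ on_arc s k st.

(** The path s followed so far is a prefix of an optimal one: its weight plus the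
    remaining distance does not exceed dist 0.  The parameter [position] tells
    where the next job lies with respect to the last arc of s; it is
    [between_jobs] at the loop head and [on_arc] once an arc covers that job. *)
Definition emitting (dist next alphas : int -> int)
    (position : seq 'I_n.+1 -> nat -> store -> Prop) k st :=
  tables_loaded next alphas st /\
  exists s, [/\ path (@darc n) ord0 s, var st x_job = k, var st x_w = last ord0 s,
     walk_weight I ord0 s + dist (last ord0 s) <= dist 0
   & emitted s k st /\ position s k st].

Lemma arcs_rcons s (w : 'I_n.+1) :
  arcs (rcons s w) = rcons (arcs s) (last ord0 s, w).
Proof. by rewrite /arcs; elim: s ord0 => //= v s IHs u; rewrite IHs. Qed.

Section Emission.

Variables dist next alphas : int -> int.
Hypothesis nodes : forall u, (u < n)%N -> settled dist next alphas u.

Lemma follow_arcP k st : (k < n)%N -> emitting dist next alphas between_jobs k st ->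
  emitting dist next alphas on_arc k (result follow_arc st).
Proof.
move=> k_lt_n [[n_st rls_st next_st alpha_st]].
move=> [s [s_path job_st w_st s_weight [s_emit]]].
rewrite /follow_arc /= job_st w_st int_succ lez_nat.
case=> [last_k|pos]; last first.
  have [e _ [<- _ /andP [_ ->]]] := pos.
  by split=> //; exists s.
rewrite last_k ltnn.
have [alpha_k [w0 [/andP [kw0 w0_le_n] next_k w0_ge _]]] := nodes k_lt_n.
pose w : 'I_n.+1 := Ordinal (w0_le_n : (w0 < n.+1)%N).
split=> //; exists (rcons s w); rewrite last_rcons; split=> //=.
- by rewrite rcons_path s_path /darc last_k.
- by rewrite next_st next_k.
- apply: le_trans s_weight; rewrite last_k.
  rewrite /walk_weight -/(arcs (rcons s w)) arcs_rcons -cats1 big_cat big_seq1 /=.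
  rewrite -addrA lerD2l; apply: le_trans w0_ge.
  by rewrite /via /arc_weight last_k.
split; last first.
  exists (last ord0 s, w); first by rewrite arcs_rcons mem_rcons mem_head.
  by rewrite /= last_rcons last_k leqnn.
move=> j /s_emit [a [e e_in e_ok] out_j]; exists a => //.
by exists e => //; rewrite arcs_rcons mem_rcons in_cons e_in orbT.
Qed.

Lemma emit_startP k st : (k < n)%N -> emitting dist next alphas on_arc k st ->
  emitting dist next alphas between_jobs k.+1 (result emit_start st).
Proof.
move=> k_lt_n [[n_st rls_st next_st alpha_st]].
move=> [s [s_path job_st w_st s_weight [s_emit [e e_in [e2 v_st ke]]]]].
rewrite /emit_start !resultE; split; first by split.
exists s; split=> //=; first by rewrite job_st int_succ.
have e1_lt_n : (e.1 < n)%N by case/andP: ke => ? _; apply: leq_ltn_trans k_lt_n.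
have [alpha_e _] := nodes e1_lt_n; split; last first.
  have [k_lt|] := ltnP k.+1 e.2; last by rewrite /between_jobs -e2 => ?; left; lia.
  by right; exists e => //; split=> //; case/andP: ke => ? _; rewrite k_lt andbT; lia.
move=> j; rewrite ltnS leq_eqVlt /= => /predU1P [jk|jk]; last first.
  by rewrite job_st int_succ eqz_nat eqSS ltn_eqF //; apply: s_emit.
exists (maxn (rls I j) (alpha I e.1)); first by exists e => //; rewrite jk.
rewrite v_st job_st int_succ rls_st (load_jobsE _ k_lt_n) alpha_st alpha_e jk eqxx.
have -> : Ordinal k_lt_n = j by apply/val_inj.
lia.
Qed.

Definition emission_time : nat :=
  n * (cost_test (Le (Var x_job +' one) (Var x_n)) +
       (budget follow_arc + budget emit_start)) +
  cost_test (Le (Var x_job +' one) (Var x_n)).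

Lemma emit_scheduleP st : emitting dist next alphas between_jobs 0 st ->
  terminates emit_schedule st emission_time (emitting dist next alphas between_jobs n).
Proof.
apply: (terminates_while (Inv := emitting dist next alphas between_jobs)).
  move=> k st1 k_lt_n st1_k; split.
    have [[n_st _ _ _] [s [_ job_st _ _ _]]] := st1_k.
    by rewrite /= n_st job_st; lia.
  apply: terminates_seq (_ : terminates _ _ _ (emitting dist next alphas on_arc k)) _.
    by apply: terminates_loopless => //; apply: follow_arcP.
  by move=> st2 st2_k; apply: terminates_loopless => //; apply: emit_startP.
move=> st1 [[n_st _ _ _] [s [_ job_st _ _ _]]].
by rewrite /= n_st job_st; lia.
Qed.

End Emission.

Hypothesis sorted : ordered I.

Lemma emitted_solved dist next alphas st :
  (forall u, (u < n)%N -> settled dist next alphas u) -> dist n = 0 ->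
  emitting dist next alphas between_jobs n st -> solved I st.
Proof.
move=> nodes dist_n [_ [s [s_path _ _ s_weight [s_emit s_last]]]].
have last_n : last ord0 s = ord_max.
  case: s_last => [last_n|[e _ [_ _ /andP [_ n_lt]]]]; first exact/val_inj.
  by have := ltn_ord e.2; lia.
have s_short : shortest_path I s.
  split=> [|s' /andP [s'_path /eqP s'_last]]; first by rewrite /path_0n s_path last_n eqxx.
  apply: le_trans (distance_le_walk dist_n nodes s'_path s'_last).
  by move: s_weight; rewrite last_n /= dist_n addr0.
have /fin_all_exists [a a_ok] : forall j, exists a : nat,
    follows I s j a /\ arr st a_out j.+1%:Z = a%:Z.
  by move=> j; have [a ? ?] := s_emit j (ltn_ord j); exists a.
exists a; split=> [j|]; first by have [] := a_ok j.
by have [] // := @shortest_path_schedule_optimal m n I sorted s a s_short;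
  move=> j; have [] := a_ok j.
Qed.

Lemma shortest_path_programP :
  terminates shortest_path_program (input I)
    (budget (x_v <~ Var x_n ;; x_alpha <~ Var x_m) +
      (distances_time + (budget (x_w <~ zero ;; x_job <~ zero) + emission_time)))%N
    (solved I).
Proof.
apply: terminates_seq (_ : terminates _ _ _ (distances_from n)) _.
  apply: terminates_loopless => //=; split=> //=; first by rewrite alpha_n.
  by move=> u; lia.
move=> st1 /compute_distancesP run; apply: terminates_seq run _ => {}st1.
move=> [[n_st _ rls_st _ _] v_st _ dist_n nodes].
apply: terminates_seq (_ : terminates _ _ _
  (emitting (arr st1 a_dist) (arr st1 a_next) (arr st1 a_alpha) between_jobs 0)) _.
  apply: terminates_loopless => //; split=> //; exists [::]; split=> //.
    by rewrite /walk_weight big_nil add0r.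
  by split; [move=> j | left].
move=> st2 /(emit_scheduleP nodes) run; apply: (terminates_weaken run) => // st3.
exact: emitted_solved.
Qed.

End Correctness.

Theorem theorem4 :
  (forall (m n : nat) (I : instance m n) (s : seq 'I_n.+1),
     ordered I -> shortest_path I s ->
     (forall j : 'I_n, allows I (path_spans I s) j) /\
     (exists R : 'I_n -> {set 'I_m},
        optimal I R /\ cancelled R = \bigcup_(S <- path_spans I s) S)) /\
  (exists (prog : cmd) (C : nat),
     forall (m n : nat) (I : instance m n),
       0 < n -> ordered I ->
       exists (st : store) (t : nat),
         [/\ exec prog (input I) st t, t <= C * n ^ 2 & solved I st]).
Proof.
split=> [m n I s sorted s_short|].
  have [a a_s] := follows_exists I s_short.1; split=> [j|]; last first.
    exists (fun j => possession I j (a j)); exact: shortest_path_schedule_optimal.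
  have [a_ok [S S_in sub]] := follows_ok (a_s j).
  by exists S, (possession I j (a j)); split=> //; apply/possessionsP; exists (a j).
(* The concrete operation counts stay well below 200 n^2, as n is positive. *)
exists shortest_path_program, 200 => m n I n_gt0 sorted.
have [st [t [run t_le solved_st]]] := shortest_path_programP sorted.
exists st, t; split=> //; apply: leq_trans t_le _.
rewrite /distances_time /emission_time /=.
nia.
Qed.
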